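(* Let $0 < \varepsilon < 1/2$ and let $W \geq 1$ be an integer. Set $\lambda = \frac{\varepsilon}{100W}$. Let $\beta \geq \beta^- + 2$ (with $\beta \geq 3$) be integers such that $\frac{\beta + 6W}{\log(\beta + 6W)} \geq 2 W^2\lambda^{-2}$ and $\beta^- - 6W \geq (1 - \lambda) \cdot (\beta + 6W)$. Let $G=(V,E)$ be an edge-weighted multi-graph with integer edge weights in $\{1,\dots,W\}$, together with capacities $\{b_v\}_{v\in V}$. Then any $(\beta, \beta^-)$-$w$-$b$-EDCS $H$ of $G$ contains a $b$-matching $M_H$ such that $\left(2 - \frac{1}{2W} + \varepsilon\right)\cdot w(M_H) \geq w(M_G)$, where $M_G$ is a maximum weight $b$-matching of $G$.
   Context: A weighted multi-graph $G=(V,E)$ has a multi-set $E$ of weighted edges $(u,v,k)$ with $u\neq v$ (no self-loops) and weight $w(e)=k\in\{1,\dots,W\}$; parallel edges, possibly of equal weight, are allowed. Each vertex $v$ has a capacity $b_v$, a positive integer, and it is assumed that the number of edges between any two vertices $u,v$ is at most $\min(b_u,b_v)$. For a subgraph (sub-multiset of edges) $H$, $\delta_H(v)$ is the multi-set of edges of $H$ incident to $v$, $\deg_H(v)=|\delta_H(v)|$, and $\mathbf{w}\!\deg_H(v)=\sum_{e\in\delta_H(v)} w(e)$. A $b$-matching is a multi-set of edges $M$ with at most $b_v$ edges of $M$ incident to each $v$; its weight $w(M)$ is the sum of its edge weights. For integers $\beta\geq 3$ and $\beta^-\leq \beta-2$, a subgraph $H$ of $G$ is a $(\beta,\beta^-)$-$w$-$b$-EDCS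 of $G$ if (i) for every edge $(u,v,w_{uv})\in H$, $\frac{\mathbf{w}\!\deg_H(u)}{b_u}+\frac{\mathbf{w}\!\deg_H(v)}{b_v}\leq \beta\cdot w_{uv}$, and (ii) for every edge $(u,v,w_{uv})\in G\setminus H$, $\frac{\mathbf{w}\!\deg_H(u)}{b_u}+\frac{\mathbf{w}\!\deg_H(v)}{b_v}\geq \beta^-\cdot w_{uv}$. *)

(* Defs.v *)
From mathcomp Require Import all_boot all_order all_algebra.

Set Implicit Arguments.
Unset Strict Implicit.
Unset Printing Implicit Defensive.

Import Order.TTheory GRing.Theory Num.Theory.
Local Open Scope ring_scope.

(* Every edge has its own identity in E, so parallel edges, even of equal
   weight, are distinct elements of E, and a sub-multiset of the edges is a
   set {set E}. Edges are undirected: the order of the two endpoints is an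
   arbitrary choice that no definition below depends on. *)
Record wmgraph (V E : finType) := WMGraph {
  end1 : E -> V;
  end2 : E -> V;
  weight : E -> nat;
  end1_neq_end2 : forall e : E, end1 e != end2 e
}.

Section WMGraphTheory.
Variables (V E : finType) (G : wmgraph V E).
Implicit Types (H M : {set E}) (u v : V) (e : E) (b : V -> nat).

Definition incident v e : bool := (end1 G e == v) || (end2 G e == v).

Definition edges_between u v : {set E} :=
  [set e | incident u e && incident v e].

Definition weights_in_range (W : nat) : Prop :=
  forall e, (1 <= weight G e <= W)%N.

Definition capacities b : Prop :=
  (forall v, (0 < b v)%N) /\
  (forall u v, u != v -> (#|edges_between u v| <= minn (b u) (b v))%N).

Definition inc_edges H v : {set E} := [set e in H | incident v e].

Definition deg H v : nat := #|inc_edges H v|.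

Definition wdeg H v : nat := (\sum_(e in inc_edges H v) weight G e)%N.

Definition total_weight M : nat := (\sum_(e in M) weight G e)%N.

Definition b_matching b M : Prop := forall v, (deg M v <= b v)%N.

Definition max_weight_b_matching b M : Prop :=
  b_matching b M /\
  (forall M', b_matching b M' -> (total_weight M' <= total_weight M)%N).

Definition edge_load b H e : rat :=
  (wdeg H (end1 G e))%:R / (b (end1 G e))%:R
  + (wdeg H (end2 G e))%:R / (b (end2 G e))%:R.

Definition w_b_EDCS b (beta beta_minus : int) H : Prop :=
  (forall e, e \in H ->
     edge_load b H e <= beta%:~R * (weight G e)%:R) /\
  (forall e, e \notin H ->
     beta_minus%:~R * (weight G e)%:R <= edge_load b H e).

End WMGraphTheory.

(* Main.v *)
Require Import Defs.
From mathcomp Require Import all_boot all_order all_algebra.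
From mathcomp Require Import perm reals sequences exp.
From mathcomp Require Import ring lra zify.

Set Implicit Arguments.
Unset Strict Implicit.
Unset Printing Implicit Defensive.

Import Order.TTheory GRing.Theory Num.Theory.
Local Open Scope ring_scope.

(* Write B for beta + 6W.  Split every vertex v into b_v copies and give each
   edge at v to one of them, so that the copies of v get the same weight up to
   W, parallel edges go to distinct copies, and M_G becomes a matching; up to
   2W the EDCS inequalities survive.  Cut the copies at random, with the ends
   of each edge of M_G on opposite sides.  At a copy v the weight of the
   H-edges across the cut deviates from its mean by noise of standard
   deviation O(W sqrt B) = O(lambda B), so a first moment argument yields a cut
   where the relevant total noise is O(lambda W) w(M_G).

   In this bipartite graph Egervary's theorem gives an integral cover
   y <= W of the H-edges and a matching M_H with sum y <= w(M_H).  Put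
   a_v = wdeg_H(v) / B and s_v = (a_v - y_v)^+.  If an edge e = uv of M_G is not
   covered, its deficit d_e = w(e) - y_u - y_v >= 1 is at most s_u + s_v, while an
   H-edge uz has s_u <= y_z - a_z.  Sending s_u from each end u of an uncovered
   edge to its neighbours, proportionally to the weights of the edges, z gets
   F_z <= a_z, and S = sum F = sum s satisfies
     S / 2 <= sum s^2 <= sum F_z (y_z - F_z).
   As y_z is an integer at most W, this forces S <= (1 - 1/(2W)) sum y, whence
   w(M_G) <= sum y + S <= (2 - 1/(2W)) w(M_H), all up to the noise. *)

(** * Weighted matchings in bipartite multigraphs *)

Section Bipartite.
Local Open Scope nat_scope.
Variables (V E : finType) (G : wmgraph V E).
Implicit Types (F M N : {set E}) (u v x y z : V) (e : E).

Definition matching M := [forall v, deg G M v <= 1].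

Lemma matchingP M :
  reflect (forall v e e', e \in M -> e' \in M -> incident G v e ->
             incident G v e' -> e = e') (matching M).
Proof.
apply: (iffP forallP) => [mM v e e' eM e'M ve ve'|mM v].
  have /card_le1_eqP h := mM v.
  by apply: h; rewrite inE ?eM ?e'M.
by apply/card_le1_eqP => e e'; rewrite !inE => /andP[? ?] /andP[? ?]; apply: (mM v).
Qed.

Definition covered M v := [exists e in M, incident G v e].

Lemma coveredPn M v : reflect (forall e, e \in M -> ~~ incident G v e) (~~ covered M v).
Proof.
rewrite negb_exists_in; exact: forall_inP.
Qed.

Lemma incident_end1 e : incident G (end1 G e) e.
Proof. by rewrite /incident eqxx. Qed.

Lemma incident_end2 e : incident G (end2 G e) e.
Proof. by rewrite /incident eqxx orbT. Qed.

Definition weight_of (wt : E -> nat) M := \sum_(e in M) wt e.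

Section Cover.
Variables (side : V -> bool).

Definition crossing F := forall e, e \in F -> side (end1 G e) != side (end2 G e).

Definition max_matching F (wt : E -> nat) M :=
  [&& M \subset F, matching M &
   [forall M' : {set E}, (M' \subset F) && matching M' ==> (weight_of wt M' <= weight_of wt M)]].

Lemma max_matchingP F wt M : max_matching F wt M ->
  [/\ M \subset F, matching M &
   forall M', M' \subset F -> matching M' -> weight_of wt M' <= weight_of wt M].
Proof.
case/and3P=> sM mM /forallP hM; split=> // M' sM' mM'.
by have /implyP := hM M'; apply; rewrite sM'.
Qed.

Lemma max_matching_exists F wt : exists M, max_matching F wt M.
Proof.
have P0 : (set0 \subset F) && matching set0.
  by rewrite sub0set; apply/matchingP => v e e'; rewrite inE.
exists [arg max_(M > set0 | (M \subset F) && matching M) weight_of wt M].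
case: arg_maxnP => // M /andP[sM mM] hM.
by apply/and3P; split=> //; apply/forallP => M'; apply/implyP; apply: hM.
Qed.

(** Testing the first end is enough: the exchange is made along a set that no edge of [M] or [N]
    leaves. *)
Definition swap (S : {set V}) M N : {set E} :=
  [set e | if end1 G e \in S then e \in N else e \in M].

Definition closed_for (S : {set V}) M :=
  forall e, e \in M -> (end1 G e \in S) = (end2 G e \in S).

Lemma closed_incident S M v e : closed_for S M -> e \in M -> incident G v e ->
  (end1 G e \in S) = (v \in S).
Proof. by move=> cM eM /orP[/eqP <-//|/eqP <-]; apply: cM. Qed.

Lemma swap_matching S M N : closed_for S M -> closed_for S N ->
  matching M -> matching N -> matching (swap S M N).
Proof.
move=> cM cN /matchingP mM /matchingP mN; apply/matchingP => v e e'.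
rewrite !inE => he he' ve ve'.
have hin f : (if end1 G f \in S then f \in N else f \in M) -> incident G v f ->
    (end1 G f \in S) = (v \in S).
  by case: ifP => h fX vf; [rewrite -h (closed_incident cN fX vf) | rewrite -h (closed_incident cM fX vf)].
move: (hin _ he ve) (hin _ he' ve') => h1 h2; move: he he'; rewrite h1 h2.
by case: ifP => _ eX e'X; [apply: (mN v)|apply: (mM v)].
Qed.

Lemma swap_weight S M N wt :
  weight_of wt (swap S M N) + weight_of wt (swap S N M) = weight_of wt M + weight_of wt N.
Proof.
have H A B : weight_of wt (swap S A B) =
    \sum_(e in A | end1 G e \notin S) wt e + \sum_(e in B | end1 G e \in S) wt e.
  rewrite /weight_of (bigID (fun e => end1 G e \in S)) /= addnC; congr (_ + _); apply: eq_bigl => e;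
  by rewrite !inE; case: (end1 G e \in S); rewrite ?andbT ?andbF.
rewrite !H addnACA [X in X + _]addnC addnACA.
rewrite /weight_of [in RHS](bigID (fun e => end1 G e \in S)) /=.
rewrite [in X in _ = _ + X](bigID (fun e => end1 G e \in S)) /=; lia.
Qed.

(* Otherwise some maximum M misses one end u of [e0], and some maximum N the other
   end v.  The M/N-alternating path from u, which starts with an N-edge, cannot
   reach v by parity; exchanging M and N along it turns N into a maximum
   matching missing both ends of [e0]. *)
Lemma essential_vertex F wt e0 : crossing F -> e0 \in F -> 0 < wt e0 ->
  exists v, forall M, max_matching F wt M -> covered M v.
Proof.
move=> cF e0F w0; set u := end1 G e0; set v := end2 G e0.
case: (boolP [exists M, max_matching F wt M && ~~ covered M u]); last first.
  move=> /existsPn h; exists u => M mM.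
  by have := h M; rewrite mM /= negbK.
case/existsP => M /andP[maxM uM].
case: (boolP [exists M, max_matching F wt M && ~~ covered M v]); last first.
  move=> /existsPn h; exists v => N mN.
  by have := h N; rewrite mN /= negbK.
case/existsP => N /andP[maxN vN]; exfalso.
have [sM mM hM] := max_matchingP maxM; have [sN mN hN] := max_matchingP maxN.
have suv : side u != side v by apply: cF.
(* Steps of alternating paths from [u]. By bipartiteness the side of a vertex encodes the parity:
   [N]-edges leave the side of [u], [M]-edges the other side. *)
pose r : rel V := fun x y => (x != y) &&
  [exists e in (if side x == side u then N else M), incident G x e && incident G y e].
pose S := [set x | connect r u x].
have cross e x y : e \in F -> incident G x e -> incident G y e -> x != y -> side x != side y.
  by move=> /cF he /orP[]/eqP <- /orP[]/eqP <-; rewrite ?eqxx // [side _ == _]eq_sym.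
have sMN x e : (e \in if side x == side u then N else M) -> e \in F.
  by case: ifP => _; apply/subsetP.
have pred x : x \in S -> x = u \/ exists2 z, z \in S & r z x.
  rewrite inE => /connectP[p pp ->]; case: (lastP p) pp => [|q t]; first by left.
  rewrite rcons_path last_rcons => /andP[pq rt]; right; exists (last u q) => //.
  by rewrite inE; apply/connectP; exists q.
(* No edge of [M] or [N] leaves [S]: at [x] one kind extends the path, and the only edge of the
   other kind is the one by which [x] was reached; at [u] there is none, since [M] misses [u]. *)
have clo X x e y : x \in S -> (X = M) \/ (X = N) -> e \in X -> incident G x e ->
    incident G y e -> y \in S.
  move=> xS hX eX xe ye; have [<-//|xy] := eqVneq x y.
  have sX : e \in F by case: hX eX => -> ; apply/subsetP.
  have mX : matching X by case: hX => ->.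
  have [e1|ne1] := eqVneq X (if side x == side u then N else M).
    move: xS; rewrite !inE => /connect_trans; apply; apply: connect1.
    by rewrite /r xy /=; apply/existsP; exists e; rewrite -e1 eX xe ye.
  case: (pred x xS) => [xu|[z zS /andP[zx /existsP[f /and3P[fX zf xf]]]]].
    move: ne1; rewrite xu eqxx => nXN; have XM: X = M by case: hX nXN => // ->; rewrite eqxx.
    by have /coveredPn/(_ e) := uM; rewrite -XM -xu xe => /(_ eX).
  have szx := cross _ _ _ (sMN _ _ fX) zf xf zx.
  have fX' : f \in X.
    move: szx fX ne1; case: (side x) (side z) (side u) hX => [] [] [] //= [] -> //=; rewrite ?eqxx //.
  have ef : e = f by move/matchingP: mX => /(_ x); apply.
  have syx := cross _ _ _ sX xe ye xy.
  suff -> : y = z by [].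
  move: ye zf xe; rewrite -{}ef /incident => /orP[]/eqP ey /orP[]/eqP ez /orP[]/eqP ex; subst => //;
  by move: zx xy; rewrite ?ey ?ez ?ex ?eqxx.
have uS : u \in S by rewrite inE.
have vS : v \notin S.
  apply/negP => /pred[vu|[z zS /andP[zv /existsP[f /and3P[fX zf vf]]]]].
    by move: suv; rewrite vu eqxx.
  have szv := cross _ _ _ (sMN _ _ fX) zf vf zv.
  have fN : f \in N by move: suv szv fX; case: (side z) (side u) (side v) => [] [] [].
  by have /coveredPn/(_ f fN) := vN; rewrite vf.
have cl X : (X = M) \/ (X = N) -> closed_for S X.
  by move=> hX e eX; apply/idP/idP => h; apply: (clo X _ e _ h hX eX);
    rewrite ?incident_end1 ?incident_end2.
have cM : closed_for S M by apply: cl; left.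
have cN : closed_for S N by apply: cl; right.
have hsum := swap_weight S M N wt.
have m1 := swap_matching cM cN mM mN; have m2 := swap_matching cN cM mN mM.
have s1 (X Y : {set E}) : X \subset F -> Y \subset F -> swap S X Y \subset F.
  by move=> /subsetP sX /subsetP sY; apply/subsetP => e; rewrite inE; case: ifP => _; [apply: sY|apply: sX].
set N' := swap S N M in hsum m2.
have hM' := hM _ (s1 _ _ sM sN) m1.
have e0N' : forall e x, e \in N' -> incident G x e -> incident G x e0 -> False.
  move=> e x; rewrite inE => eN' xe xe0.
  have hin : (end1 G e \in S) = (x \in S).
    by move: eN'; case: ifP => h eX; rewrite -h; [rewrite (closed_incident cM eX xe)|rewrite (closed_incident cN eX xe)].
  move: eN'; rewrite hin; case/orP: xe0 => /eqP hx; rewrite -hx in xe *.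
    by rewrite uS => eM; have /coveredPn/(_ _ eM) := uM; rewrite xe.
  by rewrite (negbTE vS) => eN; have /coveredPn/(_ _ eN) := vN; rewrite xe.
have nN' : e0 \notin N' by apply/negP => h; apply: (e0N' e0 u h); rewrite incident_end1.
have m3 : matching (e0 |: N').
  apply/matchingP => x e e' /setU1P[->|eN'] /setU1P[->|e'N'] // xe xe'.
  - by case: (e0N' e' x).
  - by case: (e0N' e x).
  - by move/matchingP: m2 => /(_ x); apply.
have s3 : e0 |: N' \subset F by rewrite subUset sub1set e0F s1.
have := hN _ s3 m3; rewrite [X in X <= _]/weight_of big_setU1 //= -/(weight_of wt N').
move: hsum hM'; clear -w0; lia.
Qed.

(* Decreasing the weights at an essential vertex v by one decreases the maximum by
   one, so that a cover for the new weights is completed by raising y v. *)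
Theorem egervary F wt : crossing F ->
  exists M (y : V -> nat), [/\ M \subset F, matching M,
    forall e, e \in F -> wt e <= y (end1 G e) + y (end2 G e)
    & \sum_v y v <= weight_of wt M].
Proof.
move=> cF; have [n] := ubnP (weight_of wt F); elim: n wt => // n IHn wt.
rewrite ltnS => hn.
have [F0|] := boolP [forall e in F, wt e == 0].
  exists set0, (fun=> 0); split; rewrite ?sub0set //.
  - by apply/matchingP => v e e'; rewrite inE.
  - by move=> e /(forall_inP F0) /eqP ->.
  - by rewrite big1.
rewrite negb_forall_in => /exists_inP[e0 e0F]; rewrite -lt0n => w0.
pose Fp := [set e in F | 0 < wt e].
have cFp : crossing Fp by move=> e; rewrite inE => /andP[/cF].
have e0Fp : e0 \in Fp by rewrite inE e0F.
have [v hv] := essential_vertex cFp e0Fp w0.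
(* Truncation acts only on edges of weight 0, hence the restriction to [Fp] in [dec]. *)
pose wt' e := wt e - incident G v e.
have dec M : matching M -> M \subset Fp ->
    weight_of wt M = weight_of wt' M + covered M v.
  move=> mM sM; have [/exists_inP[e eM ve]|nc] := boolP (covered M v).
    rewrite /weight_of (bigD1 e) //= [in RHS](bigD1 e) //= /wt' ve.
    have we : 0 < wt e by have := subsetP sM e eM; rewrite inE => /andP[].
    rewrite addnAC subnK //; congr (_ + _); apply: eq_bigr => f /andP[fM fe].
    case vf: (incident G v f); rewrite ?subn0 //.
    by case/eqP: fe; move/matchingP: mM => /(_ v); apply.
  rewrite addn0; apply: eq_bigr => f fM; move/coveredPn: nc => /(_ f fM).
  by rewrite /wt' => /negbTE->; rewrite subn0.
have [Mx hMx] := max_matching_exists Fp wt.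
have [sMx mMx hmax] := max_matchingP hMx.
have cvx := hv _ hMx.
have hn' : weight_of wt' F < n.
  apply: leq_trans hn; rewrite /weight_of.
  have /exists_inP[e eMx ve] := cvx.
  have : e \in Fp by apply: (subsetP sMx).
  rewrite inE => /andP[eF we].
  rewrite (bigD1 e) //= [X in _ < X](bigD1 e) //= -addSn leq_add //.
    by rewrite /wt' ve subn1 prednK.
  by apply: leq_sum => f _; apply: leq_subr.
have [M [y [sM mM hy hs]]] := IHn wt' hn'.
exists Mx, (fun x => y x + (x == v)); split=> //.
- by apply: (subset_trans sMx); apply/subsetP => e; rewrite inE => /andP[].
- move=> e eF; have := hy e eF; rewrite /wt' /incident; do 2!case: eqP => _ /=; clear; lia.
rewrite big_split /= [X in _ + X](bigD1 v) //= eqxx [X in _ + (_ + X)]big1; last by move=> x /negbTE->.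
have [Mz smz] : exists2 Mz : {set E},
    [/\ Mz \subset Fp, matching Mz & Mz \subset M] & weight_of wt' Mz = weight_of wt' M.
  exists (M :&: Fp); first split; rewrite ?subsetIl ?subsetIr //.
    apply/matchingP => x e e'; rewrite !inE => /andP[h _] /andP[h' _].
    by move/matchingP: mM => /(_ x); apply.
  rewrite /weight_of [in RHS](bigID (mem Fp)) /= [X in _ = _ + X]big1 ?addn0.
    by apply: eq_bigl => e; rewrite inE.
  move=> e /andP[eM]; rewrite inE (subsetP sM _ eM) /= -leqNgt leqn0 => /eqP.
  by rewrite /wt' => ->.
move=> wz; case: smz => sMz mMz _.
have := dec _ mMz sMz; have := hmax _ sMz mMz.
have [cz|ncz] := boolP (covered Mz v); first by move: hs; rewrite -wz; clear; lia.
(* If [Mz] misses [v] it cannot be maximum, so the unit needed to raise [y v] is still available. *)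
have lt : weight_of wt Mz < weight_of wt Mx.
  rewrite ltn_neqAle hmax // andbT; apply: contra ncz => /eqP eqw; apply: hv.
  by apply/and3P; split=> //; apply/forallP=> M'; apply/implyP=> /andP[? ?]; rewrite eqw hmax.
by move: hs lt; rewrite -wz; clear; lia.
Qed.

End Cover.
End Bipartite.

(** * Distributing the edges at a vertex *)

(** Meant for the edges at one vertex: [cl] groups those that must go to different copies. No class
    exceeds [b], so numbering each class gives an admissible assignment, and balance comes from
    minimising among these. *)
Lemma balanced_assignment (E C : finType) (A : {set E}) (cl : E -> C)
    (wt : E -> nat) (W b : nat) :
  (0 < b)%N -> (forall e, e \in A -> (wt e <= W)%N) ->
  (forall k, (#|[set e in A | cl e == k]| <= b)%N) ->
  exists f : E -> 'I_b,
    (forall e e', e \in A -> e' \in A -> cl e = cl e' -> f e = f e' -> e = e') /\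
    (forall i j, (\sum_(e in A | f e == i) wt e <=
                  \sum_(e in A | f e == j) wt e + W)%N).
Proof.
case: b => // b _ hW hb.
pose load (f : {ffun E -> 'I_b.+1}) i := (\sum_(e in A | f e == i) wt e)%N.
pose inj (f : {ffun E -> 'I_b.+1}) :=
  [forall e, forall e', [&& e \in A, e' \in A, cl e == cl e' & f e == f e'] ==> (e == e')].
have injP (f : {ffun E -> 'I_b.+1}) : reflect
    (forall e e', e \in A -> e' \in A -> cl e = cl e' -> f e = f e' -> e = e') (inj f).
  apply: (iffP forallP) => [h e e' eA e'A ce fe|h e].
    by have /forallP/(_ e') := h e; rewrite eA e'A ce fe !eqxx => /eqP.
  by apply/forallP => e'; apply/implyP => /and4P[eA e'A /eqP ce /eqP fe]; apply/eqP/h.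
pose cls k := enum [set e in A | cl e == k].
have inj0 : inj [ffun e => inord (index e (cls (cl e)))].
  apply/injP => e e' eA e'A ce; rewrite !ffunE ce => /(congr1 val) /=.
  have mem x : x \in A -> x \in cls (cl x) by move=> xA; rewrite mem_enum inE xA eqxx.
  have lt x : x \in A -> (index x (cls (cl x)) < b.+1)%N.
    by move=> xA; apply: leq_trans (hb (cl x)); rewrite cardE index_mem mem.
  have := lt e eA; have := mem e eA; rewrite ce => me le.
  rewrite !inordK ?lt // => eqi.
  by rewrite -(nth_index e me) eqi nth_index ?mem.
(* At a minimum of the sum of squared loads, if i exceeded j by more than W, then
   exchanging i and j on a class heavier at i would decrease the sum. *)
pose pot f := (\sum_i load f i ^ 2)%N.
case: (arg_minnP pot inj0) => f /injP fi fmin.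
exists f; split=> // i j.
have [->|ij] := eqVneq i j; first exact: leq_addr.
rewrite leqNgt; apply/negP => lt.
pose ld (g : {ffun E -> 'I_b.+1}) k x := (\sum_(e in A | (g e == x) && (cl e == k)) wt e)%N.
have load_cl g x : load g x = (\sum_k ld g k x)%N.
  rewrite /load (partition_big cl xpredT) //=; apply: eq_bigr => k _.
  by apply: eq_bigl => e; rewrite andbA.
have [k hk] : exists k, (ld f k j < ld f k i)%N.
  apply/existsP; rewrite -[X in is_true X]negbK negb_exists; apply/negP => /forallP h.
  suff : (load f i <= load f j)%N by move: lt; rewrite -/(load f i) -/(load f j); lia.
  by rewrite !load_cl; apply: leq_sum => k _; rewrite leqNgt.
have ldW : (ld f k i <= W)%N.
  rewrite /ld; have [/existsP[e /and3P[eA /eqP fe /eqP ce]]|/existsPn no] :=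
    boolP [exists e, [&& e \in A, f e == i & cl e == k]]; last first.
    by rewrite big_pred0 // => e; apply/negbTE/no.
  rewrite (bigD1 e) /=; last by rewrite eA fe ce !eqxx.
  rewrite big_pred0 ?addn0 ?hW // => e'.
  apply/negbTE/negP => /andP[/and3P[e'A /eqP fe' /eqP ce'] /eqP]; apply.
  by apply: fi => //; rewrite ?ce ?ce' ?fe ?fe'.
pose g := [ffun e => if cl e == k then tperm i j (f e) else f e].
have gi : inj g.
  apply/injP => e e' eA e'A ce; rewrite !ffunE ce; case: ifP => _.
    by move/perm_inj; apply: fi.
  exact: fi.
have ldg k' x : ld g k' x = ld f k' (if k' == k then tperm i j x else x).
  apply: eq_bigl => e; rewrite ffunE; have [<-|nk] := eqVneq (cl e) k'; last by rewrite !andbF.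
  rewrite !andbT; case: ifP => // _; congr (_ && _).
  by rewrite (can2_eq (tpermK i j) (tpermK i j)).
have lg x : load g x = (load f x - ld f k x + ld f k (tperm i j x))%N.
  rewrite !load_cl (bigD1 k) //= [in RHS](bigD1 k) //= ldg eqxx addKn addnC.
  by congr (_ + _)%N; apply: eq_bigr => k' /negbTE nk; rewrite ldg nk.
have ldle x : (ld f k x <= load f x)%N by rewrite load_cl (bigD1 k) //= leq_addr.
have := fmin g gi; rewrite /pot (bigD1 i) //= (bigD1 j) 1?eq_sym //=.
rewrite [X in (_ <= X)%N](bigD1 i) //= [X in (_ <= _ + X)%N](bigD1 j) 1?eq_sym //=.
rewrite (lg i) (lg j) tpermL tpermR.
rewrite [X in (_ <= _ + (_ + X))%N](eq_bigr (fun x => load f x ^ 2)%N); last first.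
  move=> x /andP[xi xj]; rewrite lg tpermD 1?eq_sym // addnC subnKC //.
move: lt hk ldW (ldle i) (ldle j); rewrite -/(load f i) -/(load f j).
set p := load f i; set q := load f j; set d1 := ld f k i; set d2 := ld f k j.
move: (\sum_(_ | _) _)%N p q d1 d2 => rest p q d1 d2; clear.
move=> h1 h2 h3 h4 h5.
(* With [d = d1 - d2] the loads become [p - d] and [q + d]. The sum of squares drops by
   [2d(p - q - d)], which is positive as [p - q > W >= d]. *)
have -> : (p - d1 + d2 = p - (d1 - d2))%N by lia.
have -> : (q - d2 + d1 = q + (d1 - d2))%N by lia.
have dW : (d1 - d2 <= W)%N by lia.
have d0 : (0 < d1 - d2)%N by lia.
have [r pr] : exists r, p = (r + (d1 - d2))%N by exists (p - (d1 - d2))%N; lia.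
move: (d1 - d2)%N dW d0 pr h1 => d dW d0 ->; rewrite addnK => h.
have : (q < r)%N by lia.
clear -d0; nia.
Qed.

(** * Random cuts *)

Section Darts.
Variables (V E : finType) (G : wmgraph V E).
Implicit Types (H M : {set E}) (d : E * bool).

(** A dart [(e, a)] is the edge [e] with a chosen source, which treats both ends uniformly in
    sums. *)
Definition src d := if d.2 then end1 G d.1 else end2 G d.1.
Definition dst d := src (d.1, ~~ d.2).

Lemma dart_eqP d d' : d.1 = d'.1 -> src d = src d' -> d = d'.
Proof.
case: d d' => [e a] [e' a'] /= <-; rewrite /src /=.
have := end1_neq_end2 G e.
by case: a a' => [] [] //= /eqP h heq; case: h; rewrite heq.
Qed.

Lemma incident_src d : incident G (src d) d.1.
Proof. by rewrite /incident /src; case: d.2; rewrite eqxx ?orbT. Qed.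

Lemma incidentP v e : reflect (exists2 d, d.1 = e & src d = v) (incident G v e).
Proof.
apply: (iffP orP) => [[]/eqP <-|[d <- <-]]; first by exists (e, true).
  by exists (e, false).
by rewrite /src; case: d.2; [left|right].
Qed.

Lemma sum_darts_flip (R : nmodType) (P : pred (E * bool)) (g : E * bool -> R) :
  \sum_(d | P d) g d = \sum_(d | P (d.1, ~~ d.2)) g (d.1, ~~ d.2).
Proof.
have K : involutive (fun d : E * bool => (d.1, ~~ d.2)) by case=> e a /=; rewrite negbK.
by rewrite (reindex_inj (inv_inj K)).
Qed.

Lemma sum_darts (R : nmodType) H (g : E * bool -> R) :
  \sum_(d | d.1 \in H) g d = \sum_(e in H) (g (e, true) + g (e, false)).
Proof.
rewrite (eq_bigl (fun d : E * bool => (d.1 \in H) && true)); last by move=> d; rewrite andbT.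
rewrite (eq_bigr (fun d : E * bool => g (d.1, d.2))); last by case.
rewrite -(pair_big (fun e => e \in H) xpredT (fun e a => g (e, a))) /=.
by apply: eq_bigr => e _; rewrite big_bool.
Qed.

Lemma wdeg_darts H v :
  wdeg G H v = (\sum_(d | (d.1 \in H) && (src d == v)) weight G d.1)%N.
Proof.
rewrite big_mkcondr (sum_darts (R := nat)) /wdeg.
rewrite (eq_bigl (fun e => (e \in H) && incident G v e)); last by move=> e; rewrite inE.
rewrite big_mkcondr; apply: eq_bigr => e _; rewrite /incident /src /=.
have := end1_neq_end2 G e; case: (eqVneq (end1 G e) v) => [->|_] /=; last by rewrite add0r.
by rewrite eq_sym => /negbTE ->; rewrite addr0.
Qed.

End Darts.

Section RandomCut.
Variables (R : realFieldType) (V E : finType) (G : wmgraph V E).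
Variables (H M : {set E}) (W : nat) (B lambda : R).
Hypothesis mM : matching G M.
Hypothesis wW : weights_in_range G W.
Hypothesis parallel : forall d d' : E * bool, d.1 \in H -> d'.1 \in H ->
  src G d = src G d' -> dst G d = dst G d' -> (d.1 \in M) = (d'.1 \in M) -> d = d'.

(** The weight of [H] at [v] staying on its side minus the weight crossing the cut; thus twice the
    crossing weight is [wdeg] minus [imbalance]. *)
Definition imbalance (side : V -> bool) v : R :=
  \sum_(d | (d.1 \in H) && (src G d == v))
    (-1) ^+ (side (src G d) (+) side (dst G d)) * (weight G d.1)%:R.

(* The second end of an edge of [M] takes the side opposite to its first end; the
   other vertices choose their sides independently. *)
Let rep v := if [pick e in M | end2 G e == v] is Some e then end1 G e else v.
Let flag v := [exists e in M, end2 G e == v].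
Let cut (xi : {ffun V -> bool}) v := xi (rep v) (+) flag v.

Let rep2 e : e \in M -> rep (end2 G e) = end1 G e.
Proof.
move=> eM; rewrite /rep; case: pickP => [f /andP[fM /eqP fe]|/(_ e)]; last by rewrite eM eqxx.
congr (end1 G _); move/matchingP: mM => /(_ (end2 G e)); apply => //.
  by rewrite -fe incident_end2.
exact: incident_end2.
Qed.

Let noflag1 e : e \in M -> flag (end1 G e) = false.
Proof.
move=> eM; apply/negbTE/negP; rewrite /flag => /exists_inP[f fM /eqP fe].
have fe' : f = e.
  move/matchingP: mM => /(_ (end1 G e)); apply => //; last exact: incident_end1.
  by rewrite -fe incident_end2.
by have := end1_neq_end2 G e; rewrite -fe fe' eqxx.
Qed.

Let rep_noflag v : flag v = false -> rep v = v.
Proof.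
rewrite /rep; case: pickP => // e /andP[eM ev]; rewrite /flag => /negbT /exists_inPn /(_ e eM).
by rewrite ev.
Qed.

Let cut_crossing xi : crossing G (cut xi) M.
Proof.
move=> e eM; rewrite /cut rep2 // noflag1 // rep_noflag ?noflag1 //.
have -> : flag (end2 G e) by rewrite /flag; apply/exists_inP; exists e.
by case: (xi _).
Qed.

(** A fibre of [rep] is a single vertex or the two ends of an edge of [M], one of which is the
    representative. *)
Let rep_inj u v : rep u = rep v -> (u == rep u) = (v == rep v) -> u = v.
Proof.
move=> ruv; have [->|nu] := eqVneq u (rep u).
  by rewrite -ruv => /esym /eqP ->.
have [//|nv _] := eqVneq v (rep v).
have fl x : x != rep x -> exists2 e, e \in M & end2 G e = x.
  case fx: (flag x); last by rewrite rep_noflag ?eqxx.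
  by move: fx; rewrite /flag => /exists_inP[e eM /eqP ev] _; exists e.
have [e eM eu] := fl _ nu; have [f fM fv] := fl _ nv.
rewrite -eu -fv; congr (end2 G _).
move/matchingP: mM => /(_ (rep u)); apply => //.
  by rewrite -eu rep2 // incident_end1.
by rewrite ruv -fv rep2 // incident_end1.
Qed.

Let sgn xi v : R := (-1) ^+ cut xi v.

(** Flipping the coin of [rep u] permutes the cuts and negates the product. *)
Let sum_sgn u v : rep u != rep v -> \sum_xi sgn xi u * sgn xi v = 0.
Proof.
move=> ruv; set S := \sum_xi _.
pose flip (xi : {ffun V -> bool}) := [ffun x => xi x (+) (x == rep u)].
have flipK : involutive flip by move=> xi; apply/ffunP => x; rewrite !ffunE addbK.
suff : S = - S by move/eqP; rewrite -subr_eq0 opprK -mulr2n mulrn_eq0 /= => /eqP.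
rewrite {1}/S (reindex_inj (inv_inj flipK)) -sumrN; apply: eq_bigr => xi _.
rewrite /sgn /cut !ffunE eqxx eq_sym (negbTE ruv) addbF addbT.
by rewrite addNb signrN mulNr.
Qed.

Let sgn_sq xi v : sgn xi v * sgn xi v = 1.
Proof. by rewrite -expr2 sqrr_sign. Qed.

Let sum_sgn_le u v : \sum_xi sgn xi u * sgn xi v <= #|{ffun V -> bool}|%:R * (rep u == rep v)%:R.
Proof.
have [_|/sum_sgn ->] := eqVneq (rep u) (rep v); last by rewrite mulr0.
rewrite mulr1 -sumr_const ler_sum // => xi _.
by rewrite /sgn -signr_addb; case: addb; rewrite ?expr0 ?expr1; lra.
Qed.

(** In the expanded square, the terms of two darts cancel on average unless their targets share a
    representative; each dart has at most four such partners. *)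
Lemma sum_imbalance_sq v :
  \sum_xi imbalance (cut xi) v ^+ 2 <=
    #|{ffun V -> bool}|%:R * (4 * W%:R * (wdeg G H v)%:R).
Proof.
pose D := [pred d : E * bool | (d.1 \in H) && (src G d == v)].
pose w (d : E * bool) : R := (weight G d.1)%:R.
have imbE xi : imbalance (cut xi) v = sgn xi v * \sum_(d | D d) sgn xi (dst G d) * w d.
  rewrite mulr_sumr; apply: eq_bigr => d /andP[_ /eqP ->].
  by rewrite signr_addb -mulrA.
have -> : \sum_xi imbalance (cut xi) v ^+ 2 =
    \sum_(d | D d) \sum_(d' | D d') w d * w d' * \sum_xi sgn xi (dst G d) * sgn xi (dst G d').
  under eq_bigr => xi _.
    rewrite imbE exprMn expr2 sgn_sq mul1r expr2 mulr_suml.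
    under eq_bigr do rewrite mulr_sumr.
    over.
  rewrite exchange_big; apply: eq_bigr => d _; rewrite exchange_big; apply: eq_bigr => d' _.
  by rewrite mulr_sumr; apply: eq_bigr => xi _; ring.
rewrite wdeg_darts natr_sum !mulr_sumr; apply: ler_sum => d /andP[dH dv].
apply: le_trans (_ : \sum_(d' | D d') w d *
      (W%:R * (#|{ffun V -> bool}|%:R * (rep (dst G d) == rep (dst G d'))%:R)) <= _).
  apply: ler_sum => d' _; rewrite -mulrA; apply: ler_wpM2l; first exact: ler0n.
  apply: le_trans (_ : w d' * (#|{ffun V -> bool}|%:R * (rep (dst G d) == rep (dst G d'))%:R) <= _).
    by apply: ler_wpM2l (sum_sgn_le _ _); exact: ler0n.
  by apply: ler_wpM2r; rewrite ?mulr_ge0 ?ler0n // ler_nat; case/andP: (wW d'.1).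
rewrite -!mulr_sumr.
suff cnt : \sum_(d' | D d') (rep (dst G d) == rep (dst G d'))%:R <= 4 :> R.
  rewrite -/(w d) [leRHS](_ : _ = w d * (W%:R * (#|{ffun V -> bool}|%:R * 4))); last by ring.
  by do 3!(apply: ler_wpM2l; first exact: ler0n).
rewrite -natr_sum -big_mkcondr sum1_card ler_nat.
rewrite -[4%N]/((2 * 2)%N) -card_bool -card_prod.
(* By [rep_inj] and [parallel], two bits determine a partner: whether it ends at the representative,
   and whether it lies in [M]. *)
pose key d' := (dst G d' == rep (dst G d), d'.1 \in M).
apply: leq_trans (max_card (mem
    [set key d' | d' in [pred d' | D d' & rep (dst G d) == rep (dst G d')]])).
rewrite card_in_imset // => d1 d2 /andP[/andP[d1H /eqP s1] /eqP r1]
    /andP[/andP[d2H /eqP s2] /eqP r2] [k1 k2].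
apply: parallel => //; first by rewrite s1 s2.
by apply: rep_inj; rewrite -?r1 -?r2.
Qed.

Hypothesis lambda0 : 0 < lambda.
Hypothesis B0 : 0 < B.
Hypothesis hB : 2 * W%:R ^+ 2 <= lambda ^+ 2 * B.
Hypothesis degB : forall v, (wdeg G H v)%:R <= B * W%:R.

Lemma sum_imbalance v :
  \sum_xi `|imbalance (cut xi) v| <= #|{ffun V -> bool}|%:R * (3 / 2 * lambda * B).
Proof.
have lB : 0 < lambda * B by rewrite mulr_gt0.
(* AM-GM: |t| <= t^2 / (3 lambda B) + 3 lambda B / 4. *)
have amgm (t : R) : `|t| <= t ^+ 2 * (3 * (lambda * B))^-1 + 3 / 4 * (lambda * B).
  rewrite -[t ^+ 2]real_normK ?num_real //; set x := `|t|; set k := lambda * B in lB *.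
  rewrite -subr_ge0 (_ : _ - _ = (x - 3 / 2 * k) ^+ 2 / (3 * k)); last by field; lra.
  by apply: divr_ge0; [exact: sqr_ge0|lra].
apply: (le_trans (ler_sum _ (fun xi _ => amgm (imbalance (cut xi) v)))).
rewrite big_split /= sumr_const -mulr_suml -[_ *+ #|_|]mulr_natl.
set N : R := #|_|%:R; have N0 : 0 <= N by exact: ler0n.
have sq : \sum_xi imbalance (cut xi) v ^+ 2 <= N * (2 * (lambda * B) ^+ 2).
  apply: (le_trans (sum_imbalance_sq v)); apply: ler_wpM2l => //.
  apply: le_trans (_ : 4 * W%:R * (B * W%:R) <= _).
    by apply: ler_wpM2l => //; rewrite mulr_ge0 ?ler0n.
  have := ler_wpM2l (ltW B0) hB; rewrite !expr2; lra.
apply: le_trans (_ : N * (2 * (lambda * B) ^+ 2) * (3 * (lambda * B))^-1 + N * (3 / 4 * (lambda * B)) <= _).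
  by rewrite lerD2r; apply: ler_wpM2r => //; rewrite invr_ge0; lra.
have -> : N * (2 * (lambda * B) ^+ 2) * (3 * (lambda * B))^-1 = N * (2 / 3 * (lambda * B)).
  by field; rewrite !gt_eqF.
rewrite -mulrDr; apply: ler_wpM2l => //; lra.
Qed.

(** If every cut exceeded the bound, summing over the cuts would contradict [sum_imbalance]. The
    weights [kappa] are fixed before the cut and cannot depend on it. *)
Lemma balanced_cut (kappa : V -> R) : (forall v, 0 <= kappa v) ->
  exists2 side, crossing G side M &
    \sum_v kappa v * `|imbalance side v| <= 3 / 2 * lambda * B * \sum_v kappa v.
Proof.
move=> k0.
have [hxi|no] := boolP [exists xi,
    \sum_v kappa v * `|imbalance (cut xi) v| <= 3 / 2 * lambda * B * \sum_v kappa v].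
  by case/existsP: hxi => xi h; exists (cut xi) => //; apply: cut_crossing.
have : \sum_xi \sum_v kappa v * `|imbalance (cut xi) v| <=
    \sum_(xi : {ffun V -> bool}) 3 / 2 * lambda * B * \sum_v kappa v.
  rewrite exchange_big sumr_const -[_ *+ #|_|]mulr_natl mulrCA mulr_sumr.
  rewrite mulr_sumr.
  apply: ler_sum => v _; rewrite -mulr_sumr mulrCA
    [leRHS](_ : _ = kappa v * (#|{ffun V -> bool}|%:R * (3 / 2 * lambda * B))); last by ring.
  by apply: ler_wpM2l => //; exact: sum_imbalance.
rewrite leNgt => /negP[]; apply: ltr_sum => [|xi _].
  by apply/hasP; exists [ffun=> true]; rewrite ?mem_index_enum.
by move/existsPn: no => /(_ xi); rewrite -ltNge.
Qed.

End RandomCut.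

(** * The analysis of one cut *)

(* F is what arrives when every v sends [sg v] along its darts, in proportion to [c]. *)
Lemma flow (R : realFieldType) (T V : finType) (s t : T -> V) (c : T -> R)
    (sg m : V -> R) :
  (forall d, 0 <= c d) ->
  (forall v, 0 <= sg v <= \sum_(d | s d == v) c d) ->
  (forall d, 0 < c d -> 0 < sg (s d) -> sg (s d) <= m (t d)) ->
  exists F : V -> R,
    [/\ forall v, 0 <= F v <= \sum_(d | (t d == v) && (0 < sg (s d))) c d,
        \sum_v F v = \sum_v sg v,
        \sum_v sg v ^+ 2 <= \sum_v F v * m v
      & forall v, 0 < F v -> 0 < m v].
Proof.
move=> c0 hs hm; pose x v := \sum_(d | s d == v) c d.
(* The fraction of its capacity that [v] sends. If [x v = 0] then [sg v = 0], and the default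
   quotient 0 is right. *)
pose phi v := sg v / x v.
have sg0 v : 0 <= sg v by case/andP: (hs v).
have sgx v : sg v <= x v by case/andP: (hs v).
have phi0 v : 0 <= phi v by rewrite divr_ge0 ?(le_trans (sg0 v)).
have xphi v : x v * phi v = sg v.
  rewrite /phi; have [x0|nx] := eqVneq (x v) 0; last by rewrite mulrC divfK.
  by have := hs v; rewrite -/(x v) x0 mul0r -eq_le => /eqP.
have phi1 v : phi v <= 1.
  rewrite /phi; have := sg0 v; have := sgx v.
  have [->|nx] := eqVneq (x v) 0; first by rewrite invr0 mulr0.
  by move=> h1 h2; rewrite ler_pdivrMr ?mul1r // lt0r nx (le_trans h2).
pose f d := c d * phi (s d).
have f0 d : 0 <= f d by rewrite mulr_ge0.
have fpos d : f d != 0 -> 0 < c d /\ 0 < sg (s d).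
  rewrite /f mulf_eq0 negb_or /phi mulf_eq0 negb_or => /andP[cd /andP[sd _]].
  by rewrite !lt0r cd sd c0 sg0.
have out g : \sum_d f d * g (s d) = \sum_v sg v * g v.
  rewrite (partition_big s xpredT) //=; apply: eq_bigr => v _.
  rewrite -xphi -!mulrA mulr_suml; apply: eq_bigr => d /eqP <-.
  by rewrite /f /phi !mulrA.
have fm d : f d * sg (s d) <= f d * m (t d).
  have [->|/fpos[cd sd]] := eqVneq (f d) 0; first by rewrite !mul0r.
  by rewrite ler_wpM2l // hm.
pose F v := \sum_(d | t d == v) f d.
have into g : \sum_d f d * g (t d) = \sum_v F v * g v.
  rewrite (partition_big t xpredT) //=; apply: eq_bigr => v _.
  by rewrite /F mulr_suml; apply: eq_bigr => d /eqP ->.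
exists F; split.
- move=> v; rewrite sumr_ge0 //= /F big_mkcondr ler_sum // => d _.
  case: ifP => sd; first by rewrite /f ler_piMr.
  by have [->//|/fpos[_]] := eqVneq (f d) 0; rewrite sd.
- transitivity (\sum_v F v * 1); first by apply: eq_bigr => v _; rewrite mulr1.
  by rewrite -(into (fun=> 1)) (out (fun=> 1)); apply: eq_bigr => v _; rewrite mulr1.
- by rewrite -into; under eq_bigr do rewrite expr2; rewrite -out ler_sum.
- move=> v Fv; have [d /andP[/eqP <- fd]|no] := pickP (fun d => (t d == v) && (f d != 0)).
    by have [cd sd] := fpos d fd; apply: lt_le_trans (hm d cd sd).
  move: Fv; rewrite /F big1 ?ltxx // => d td; have := no d; rewrite td /=.
  by move/negbT; rewrite negbK => /eqP.
Qed.

(** Let [S] and [Y] be the sums of [F] and [y] over the vertices. Once the sum of [F (y - F)] is at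
    least [S / 2], the left sides sum to at least 0, which yields [S <= (1 - 1/(2W)) Y] up to the
    [theta] term. *)
Lemma flow_profile (R : realFieldType) (W y : nat) (F theta : R) :
  (0 < W)%N -> (y <= W)%N -> 0 <= F -> 0 <= theta -> F <= y%:R + theta ->
  (0 < F -> (0 < y)%N) ->
  F * (y%:R - 1 / 2 - F) <=
    (W%:R - 1 / 2) * ((1 - 1 / (2 * W%:R)) * y%:R - F) + W%:R * (F * theta).
Proof.
move=> W0 yW F0 t0 Fy hF; set w : R := W%:R.
have w1 : 1 <= w by rewrite ler1n.
have wt0 : 0 <= w * (F * theta) by rewrite !mulr_ge0 // ler0n.
pose k : R := 1 / (4 * w).
have kw : k * w = 1 / 4 by rewrite /k; field; lra.
have k0 : 0 <= k by rewrite divr_ge0 //; lra.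
have -> : (w - 1 / 2) * ((1 - 1 / (2 * w)) * y%:R - F) = (w - 1 + k) * y%:R - (w - 1 / 2) * F.
  by rewrite /k; field; lra.
move: yW; rewrite leq_eqVlt => /orP[/eqP yW|yW].
  (* The difference of the two sides is (F - (W - 1/2))^2 + W F theta. *)
  rewrite yW -/w; have := sqr_ge0 (F - (w - 1 / 2)); rewrite expr2.
  by move: kw wt0; clear; lra.
have yw : y%:R + 1 <= w :> R by rewrite /w natr1 ler_nat.
have [Fe|Fn] := eqVneq F 0.
  by rewrite Fe !(mul0r, mulr0) subr0 addr0 !mulr_ge0 ?ler0n //; lra.
have y1 : 1 <= y%:R :> R by rewrite ler1n hF // lt0r Fn.
have ky : 0 <= k * y%:R by rewrite mulr_ge0 // ler0n.
(* For [y < W] the two sides differ by this expression plus [k y]. By integrality [y <= W - 1], so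
   the product is negative only for [F] between [y] and [W - 1], where [F - y <= theta] and
   [F >= 1]. *)
have key : 0 <= (F - y%:R) * (F - (w - 1)) + w * (F * theta).
  have [h|h] := lerP F y%:R.
    rewrite addr_ge0 // mulr_le0 //; lra.
  have [h'|h'] := lerP (w - 1) F; first by rewrite addr_ge0 // mulr_ge0 //; lra.
  have e1 : (F - y%:R) * (w - 1 - F) <= theta * w by apply: ler_pM; lra.
  have e2 : theta * w <= w * (F * theta).
    by rewrite mulrC ler_wpM2l ?ler_peMl //; lra.
  lra.
move: key ky; clear; lra.
Qed.

Section Analysis.
Variables (R : realFieldType) (V E : finType) (G : wmgraph V E).
Implicit Types (M : {set E}).

Lemma sum_matching (M : {set E}) (g : V -> R) : matching G M ->
  \sum_(e in M) (g (end1 G e) + g (end2 G e)) = \sum_(v | covered G M v) g v.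
Proof.
move=> mM; rewrite -(sum_darts M (fun d => g (src G d))).
rewrite (partition_big (src G) (covered G M)) /=; last first.
  by move=> d dM; apply/exists_inP; exists d.1; rewrite ?incident_src.
apply: eq_bigr => v /exists_inP[e eM /incidentP[d de dv]].
rewrite (big_pred1 d) ?dv // => d'; apply/andP/eqP => [[dM /eqP sd]|->]; last by rewrite de dv eqxx.
apply: (@dart_eqP _ _ G); last by rewrite dv.
move/matchingP: mM => /(_ v); apply; rewrite ?de //; first by rewrite -sd incident_src.
by rewrite -de -dv incident_src.
Qed.

End Analysis.

(** * Matchings in split graphs satisfying the EDCS inequalities *)

Section NearEDCS.
Variables (R : realFieldType) (V E : finType) (G : wmgraph V E).
Variables (H M : {set E}) (W : nat) (B lambda : R).
Hypothesis W0 : (0 < W)%N.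
Hypothesis wW : weights_in_range G W.
Hypothesis mM : matching G M.
Hypothesis lambda0 : 0 < lambda.
Hypothesis B0 : 0 < B.
Hypothesis load_le : forall e, e \in H ->
  (wdeg G H (end1 G e))%:R + (wdeg G H (end2 G e))%:R <= B * (weight G e)%:R.
Hypothesis load_ge : forall e, e \in M -> e \notin H ->
  (1 - lambda) * B * (weight G e)%:R <=
  (wdeg G H (end1 G e))%:R + (wdeg G H (end2 G e))%:R.

Let a v : R := (wdeg G H v)%:R / B.

Let a0 v : 0 <= a v.
Proof. by rewrite divr_ge0 ?ler0n // ltW. Qed.

Let load_src d : d.1 \in H -> a (src G d) + a (dst G d) <= (weight G d.1)%:R.
Proof.
move=> dH; rewrite -mulrDl ler_pdivrMr // mulrC.
by case: d dH => e [] /load_le //; rewrite addrC.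
Qed.

Lemma wdeg_le v : (wdeg G H v)%:R <= B * W%:R.
Proof.
have [d /andP[dH /eqP dv]|no] := pickP (fun d => (d.1 \in H) && (src G d == v)).
  have := load_src dH; rewrite dv => h.
  rewrite mulrC -ler_pdivrMr // (le_trans _ (_ : (weight G d.1)%:R <= W%:R)) //.
    by rewrite (le_trans _ h) // lerDl.
  by rewrite ler_nat; case/andP: (wW d.1).
by rewrite wdeg_darts big_pred0 // mulr_ge0 ?ler0n // ltW.
Qed.

(** A bound on the flow into [z] that is independent of the cut, so that it may enter the weights
    [kappa]. *)
Let inflow z : R :=
  \sum_(d | [&& d.1 \in H, dst G d == z & covered G M (src G d)]) 2 * (weight G d.1)%:R / B.

Section Cut.
Variable side : V -> bool.
Hypothesis crossM : crossing G side M.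

Let F := [set e in H | side (end1 G e) != side (end2 G e)].
Let eta v : R := imbalance R G H side v / B.
(** The factor 2 makes up for the half of the weight that a typical cut loses. *)
Let c (d : E * bool) : R := if d.1 \in F then 2 * (weight G d.1)%:R / B else 0.

Let c_ge0 d : 0 <= c d.
Proof. by rewrite /c; case: ifP => // _; rewrite divr_ge0 ?mulr_ge0 ?ler0n // ltW. Qed.

Let cut_degree v : \sum_(d | src G d == v) c d = a v - eta v.
Proof.
rewrite /a wdeg_darts natr_sum /eta /imbalance -mulrBl -sumrB mulr_suml.
rewrite [RHS]big_mkcondl; apply: eq_bigr => d _; rewrite /c inE.
case: (d.1 \in H) => //=.
have -> : side (src G d) (+) side (dst G d) = (side (end1 G d.1) != side (end2 G d.1)).
  by case: d => e [] /=; rewrite /dst /src /=; do 2!case: (side _).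
by case: (_ != _) => /=; rewrite ?expr0 ?expr1; field; rewrite gt_eqF.
Qed.

Let cut_degree_dst v : \sum_(d | dst G d == v) c d = a v - eta v.
Proof.
rewrite -cut_degree sum_darts_flip; apply: eq_bigl => d.
by rewrite /dst /= negbK -surjective_pairing.
Qed.

(** Noise enters through [Phi], flow times imbalance, with factor 4, and through [Err], the
    shortfall in the deficit bounds, twice: in the bound on [S] and in that on the weight of [M]. *)
Lemma cut_matching : exists M' : {set E},
  [/\ M' \subset H, matching G M' &
    (total_weight G M)%:R * (1 - 2 * lambda) <=
    (2 - 1 / (2 * W%:R)) * (total_weight G M')%:R +
    \sum_v (4 * inflow v + 2 * (covered G M v)%:R) * `|eta v| ].
Proof.
have cF : crossing G side F by move=> e; rewrite inE => /andP[].
have [M' [y0 [sM' mM' hy0 sy0]]] := egervary (weight G) cF.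
exists M'; split=> //.
  by apply: (subset_trans sM'); apply/subsetP => e; rewrite inE => /andP[].
(* Weights are at most [W], so the capped cover is still a cover. *)
pose y v := minn (y0 v) W.
have yW v : (y v <= W)%N by exact: geq_minr.
have hy e : e \in F -> (weight G e)%:R <= (y (end1 G e))%:R + (y (end2 G e))%:R :> R.
  move=> eF; rewrite -natrD ler_nat; have := hy0 e eF; rewrite /y.
  by have /andP[_] := wW e; clear; lia.
pose Y : R := \sum_v (y v)%:R.
have sy : Y <= (total_weight G M')%:R.
  rewrite /Y -natr_sum ler_nat; apply: leq_trans sy0.
  by apply: leq_sum => v _; apply: geq_minl.
have y0' v : 0 <= (y v)%:R :> R by exact: ler0n.
have Y0 : 0 <= Y by exact: sumr_ge0.
pose D := [set e in M | ((y (end1 G e))%:R + (y (end2 G e))%:R < (weight G e)%:R :> R)].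
have sDM : {subset D <= M} by move=> e; rewrite inE => /andP[].
have mD : matching G D.
  by apply/matchingP => v e e' /sDM h /sDM h'; move/matchingP: mM => /(_ v); apply.
(* The second cap, [a v - eta v], is the capacity of the cut at [v] that [flow] requires; it costs
   at most the absolute value of [eta v]. *)
pose sg v := if covered G D v then Num.max 0 (Num.min (a v - (y v)%:R) (a v - eta v)) else 0.
pose m v : R := (y v)%:R - a v.
have x0 v : 0 <= a v - eta v by rewrite -cut_degree sumr_ge0.
have sg_ge0 v : 0 <= sg v by rewrite /sg; case: ifP => // _; rewrite le_max lexx.
have sg_le v : sg v <= a v - eta v.
  by rewrite /sg; case: ifP => // _; rewrite ge_max x0 ge_min lexx orbT.
have sg_pos v : 0 < sg v -> covered G D v /\ sg v <= a v - (y v)%:R.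
  rewrite /sg; case: ifP; rewrite ?ltxx // => _; rewrite lt_max ltxx /= => h; split=> //.
  by rewrite ge_max (ltW (lt_le_trans h _)) ge_min lexx.
have hm d : 0 < c d -> 0 < sg (src G d) -> sg (src G d) <= m (dst G d).
  rewrite /c; case: ifP; rewrite ?ltxx // => dF _ /sg_pos[_ h]; apply: (le_trans h).
  have dH : d.1 \in H by move: dF; rewrite inE => /andP[].
  have := load_src dH; have := hy _ dF; rewrite /m.
  by case: (d) => e [] /=; rewrite /dst /src /=; lra.
have hs v : 0 <= sg v <= \sum_(d | src G d == v) c d by rewrite cut_degree sg_ge0 sg_le.
have [f [fb sf sf2 fm]] := flow (t := dst G) c_ge0 hs hm.
have f0 v : 0 <= f v by case/andP: (fb v).
have fx v : f v <= a v - eta v.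
  rewrite -cut_degree_dst; have /andP[_ h] := fb v; apply: (le_trans h).
  rewrite big_mkcondr ler_sum // => d _; by case: ifP.
have f_inflow v : f v <= inflow v.
  have /andP[_ h] := fb v; apply: (le_trans h); rewrite /inflow.
  rewrite big_mkcond [leRHS]big_mkcond ler_sum // => d _.
  case: (dst G d == v) => /=; last by rewrite andbF.
  case: ifP => [/sg_pos[cD _]|_]; last by case: ifP => // _; rewrite divr_ge0 ?mulr_ge0 ?ler0n // ltW.
  have -> : covered G M (src G d).
    by case/exists_inP: cD => e /sDM eM ve; apply/exists_inP; exists e.
  rewrite /c inE andbT; case: (d.1 \in H) => //=.
  by case: ifP => // _; rewrite divr_ge0 ?mulr_ge0 ?ler0n // ltW.
pose S := \sum_v sg v.
pose Phi := \sum_v f v * `|eta v|.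
pose err e : R := lambda * (weight G e)%:R + (`|eta (end1 G e)| + `|eta (end2 G e)|).
pose Err := \sum_(e in D) err e.
have w1 : 1 <= W%:R :> R by rewrite ler1n.
have err0 e : 0 <= err e by rewrite /err !addr_ge0 // mulr_ge0 ?ler0n // ltW.
have Err0 : 0 <= Err by exact: sumr_ge0.
have Phi0 : 0 <= Phi by apply: sumr_ge0 => v _; rewrite mulr_ge0.
have up : \sum_v sg v ^+ 2 <= 1 / 2 * S +
    (W%:R - 1 / 2) * ((1 - 1 / (2 * W%:R)) * Y - S) + (W%:R + 1) * Phi.
  apply: (le_trans sf2).
  apply: le_trans (_ : \sum_v (1 / 2 * f v + (W%:R - 1 / 2) *
      ((1 - 1 / (2 * W%:R)) * (y v)%:R - f v) + (W%:R + 1) * (f v * `|eta v|)) <= _); last first.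
    by rewrite !big_split /= -!mulr_sumr sumrB -mulr_sumr sf.
  apply: ler_sum => v _.
  have fy : f v <= (y v)%:R + `|eta v|.
    have [fv0|] := ltrP 0 (f v); last by move=> h; apply: (le_trans h); rewrite addr_ge0.
    have := fm v fv0; have := fx v; have := ler_norm (- eta v); rewrite normrN /m; lra.
  have fy1 : 0 < f v -> (0 < y v)%N.
    by move=> /(fm v); rewrite /m subr_gt0 => /(le_lt_trans (a0 v)); rewrite ltr0n.
  have := flow_profile W0 (yW v) (f0 v) (normr_ge0 (eta v)) fy fy1.
  have : f v * m v <= f v * ((y v)%:R - f v + `|eta v|).
    apply: ler_wpM2l => //; have := fx v; have := ler_norm (- eta v); rewrite normrN /m; lra.
  lra.
have dE e : e \in D -> (weight G e)%:R - (y (end1 G e))%:R - (y (end2 G e))%:R - err e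
    <= sg (end1 G e) + sg (end2 G e).
  rewrite inE => /andP[eM lt].
  have eH : e \notin H.
    apply/negP => eH; have : e \in F by rewrite inE eH crossM.
    by move/hy; rewrite leNgt lt.
  have sgE x : incident G x e -> a x - (y x)%:R - `|eta x| <= sg x.
    move=> xe; rewrite /sg; have -> : covered G D x by apply/exists_inP; exists e; rewrite // inE eM.
    rewrite le_max le_min; apply/orP; right; apply/andP; split.
      by rewrite lerBlDr lerDl.
    by have := ler_norm (eta x); have := y0' x; lra.
  have := sgE _ (incident_end1 G e); have := sgE _ (incident_end2 G e).
  have : (1 - lambda) * (weight G e)%:R <= a (end1 G e) + a (end2 G e).
    by rewrite -mulrDl ler_pdivlMr // mulrAC load_ge.
  by rewrite /err; lra.
have SE : S = \sum_(e in D) (sg (end1 G e) + sg (end2 G e)).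
  rewrite sum_matching // /S [RHS]big_mkcond; apply: eq_bigr => v _.
  by rewrite /sg; case: ifP.
have low : 1 / 2 * S - 1 / 2 * Err <= \sum_v sg v ^+ 2.
  have -> : \sum_v sg v ^+ 2 = \sum_(e in D) (sg (end1 G e) ^+ 2 + sg (end2 G e) ^+ 2).
    rewrite (sum_matching (fun v => sg v ^+ 2)) // [RHS]big_mkcond; apply: eq_bigr => v _.
    by rewrite /sg; case: ifP => //; rewrite expr0n.
  rewrite SE /Err !mulr_sumr -sumrB; apply: ler_sum => e eD.
  have := dE e eD; have := err0 e.
  have d1 : 1 <= (weight G e)%:R - (y (end1 G e))%:R - (y (end2 G e))%:R :> R.
    move: eD; rewrite inE => /andP[_]; rewrite -natrD ltr_nat => h.
    by rewrite -addrA -opprD -natrD -natrB ?(ltnW h) // ler1n subn_gt0.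
  move: (sg _) (sg _) (sg_ge0 (end1 G e)) (sg_ge0 (end2 G e)) d1 => p q p0 q0 d1 e0 dS.
  (* With [s = p + q >= 1 - err e], it suffices that [s - err e <= s^2]: clear for [s >= 1], and
     otherwise [s (1 - s) <= 1 - s <= err e]. *)
  have sq : (p + q) ^+ 2 / 2 <= p ^+ 2 + q ^+ 2.
    by have := sqr_ge0 (p - q); rewrite !expr2; lra.
  suff : p + q - err e <= (p + q) ^+ 2 by lra.
  move: sq; have S0 : 0 <= p + q by rewrite addr_ge0.
  have Se : 1 - err e <= p + q by lra.
  move: (p + q) S0 Se => s s0 se _; rewrite expr2.
  have [s1|s1] := lerP 1 s.
    have : s * 1 <= s * s by rewrite ler_wpM2l. 
    lra.
  have : s * (1 - s) <= 1 * (1 - s) by rewrite ler_wpM2r; lra.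
  lra.
have SY : S <= (1 - 1 / (2 * W%:R)) * Y + 4 * Phi + Err.
  have [|lt] := lerP S ((1 - 1 / (2 * W%:R)) * Y); first by lra.
  (* [low] and [up] give [(W - 1/2)(S - T) <= (W + 1) Phi + Err / 2]; the constants 4 and 1 come
     from [W/2 <= W - 1/2] and [W + 1 <= 2W]. *)
  move: lt up low Err0 Phi0 w1; set T := (1 - _) * Y; set w : R := W%:R.
  move=> lt up low Err0 Phi0 w1.
  have h : (w - 1 / 2) * (S - T) <= (w + 1) * Phi + 1 / 2 * Err by lra.
  have h1 : w / 2 * (S - T) <= (w - 1 / 2) * (S - T) by rewrite ler_wpM2r; lra.
  have h2 : (w + 1) * Phi <= (2 * w) * Phi by rewrite ler_wpM2r; lra.
  have h3 : 1 / 2 * Err <= w / 2 * Err by rewrite ler_wpM2r; lra.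
  have : w / 2 * (S - T) <= w / 2 * (4 * Phi + Err) by lra.
  rewrite ler_pM2l; lra.
have wM : (total_weight G M)%:R <= Y + S + Err.
  rewrite /total_weight natr_sum.
  apply: le_trans (_ : \sum_(e in M) ((y (end1 G e))%:R + (y (end2 G e))%:R) +
      \sum_(e in D) (sg (end1 G e) + sg (end2 G e) + err e) <= _).
    rewrite [X in _ <= _ + X](eq_bigl (fun e => (e \in M) && (e \in D))); last first.
      by move=> e; rewrite inE andbA andbb.
    rewrite big_mkcondr -big_split /=; apply: ler_sum => e eM.
    case: ifP => [/dE|]; first by lra.
    by rewrite inE eM /= => /negbT; rewrite -leNgt addr0.
  rewrite [X in _ + X <= _]big_split /= -SE -/Err addrA !lerD2r (sum_matching (fun v => (y v)%:R)) //.
  by rewrite big_mkcond ler_sum // => v _; case: ifP.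
have ErrE : Err <= lambda * (total_weight G M)%:R + \sum_v (covered G M v)%:R * `|eta v|.
  apply: le_trans (_ : \sum_(e in M) err e <= _).
    rewrite /Err big_mkcond [leRHS]big_mkcond ler_sum // => e _.
    by case: ifP => [/sDM ->//|_]; case: ifP.
  rewrite /err big_split /= -mulr_sumr -natr_sum lerD2l (sum_matching (fun v => `|eta v|)) //.
  rewrite big_mkcond ler_sum // => v _.
  by case: (covered G M v); rewrite ?mul1r ?mul0r.
have PhiE : Phi <= \sum_v inflow v * `|eta v|.
  by apply: ler_sum => v _; rewrite ler_wpM2r.
have -> : \sum_v (4 * inflow v + 2 * (covered G M v)%:R) * `|eta v| =
   4 * (\sum_v inflow v * `|eta v|) + 2 * (\sum_v (covered G M v)%:R * `|eta v|).
  by rewrite !mulr_sumr -big_split /=; apply: eq_bigr => v _; ring.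
have YM : (2 - 1 / (2 * W%:R)) * Y <= (2 - 1 / (2 * W%:R)) * (total_weight G M')%:R.
  apply: ler_wpM2l => //; rewrite subr_ge0 ler_pdivrMr; lra.
lra.
Qed.

End Cut.

Hypothesis parallel : forall d d' : E * bool, d.1 \in H -> d'.1 \in H ->
  src G d = src G d' -> dst G d = dst G d' -> (d.1 \in M) = (d'.1 \in M) -> d = d'.
Hypothesis hB : 2 * W%:R ^+ 2 <= lambda ^+ 2 * B.

Theorem near_EDCS_matching : exists M' : {set E},
  [/\ M' \subset H, matching G M' &
    (total_weight G M)%:R * (1 - 32 * (W%:R * lambda)) <=
    (2 - 1 / (2 * W%:R)) * (total_weight G M')%:R].
Proof.
pose kappa v := 4 * inflow v + 2 * (covered G M v)%:R.
have inflow0 v : 0 <= inflow v.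
  by apply: sumr_ge0 => d _; rewrite divr_ge0 ?mulr_ge0 ?ler0n // ltW.
have kappa0 v : 0 <= kappa v by rewrite addr_ge0 ?mulr_ge0 ?ler0n.
have [side crossM hside] := balanced_cut mM wW parallel lambda0 B0 hB wdeg_le kappa0.
have [M' [sM' mM' hM']] := cut_matching crossM.
exists M'; split=> //.
set t : R := (total_weight G M)%:R in hM' *.
have ncov : \sum_(v | covered G M v) (1 : R) <= 2 * t.
  rewrite -(sum_matching (fun=> 1)) // /t /total_weight natr_sum mulr_sumr.
  apply: ler_sum => e _; have /andP[w1 _] := wW e.
  have : 1 <= (weight G e)%:R :> R by rewrite ler1n.
  by rewrite /=; lra.
(* Each of the at most [2t] matched vertices contributes [2 wdeg / B <= 2W]. *)
have total_inflow : \sum_v inflow v <= 2 * W%:R * (2 * t).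
  apply: le_trans (_ : \sum_(v | covered G M v) 2 * W%:R <= _); last first.
    under eq_bigr do rewrite -[2 * W%:R]mulr1.
    by rewrite -mulr_sumr ler_wpM2l // mulr_ge0 ?ler0n.
  rewrite /inflow.
  under eq_bigr => v _ do under eq_bigl => d do rewrite andbCA andbC.
  rewrite -(partition_big (dst G) xpredT) //=.
  rewrite (partition_big (src G) (covered G M)) /=; last by move=> d /andP[].
  apply: ler_sum => v cv.
  have -> : \sum_(d | (d.1 \in H) && covered G M (src G d) && (src G d == v)) 2 * (weight G d.1)%:R / B =
      2 * ((wdeg G H v)%:R / B).
    rewrite wdeg_darts natr_sum mulr_suml mulr_sumr; apply: eq_big => [d|d _]; last by rewrite mulrA.
    by case: eqP => [->|]; rewrite ?cv ?andbT ?andbF.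
  by rewrite ler_wpM2l // ler_pdivrMr // mulrC wdeg_le.
have sumk : \sum_v kappa v <= (16 * W%:R + 4) * t.
  rewrite /kappa big_split /= -!mulr_sumr.
  have -> : \sum_v (covered G M v)%:R = \sum_(v | covered G M v) (1 : R).
    by rewrite [RHS]big_mkcond; apply: eq_bigr => v _; case: covered.
  lra.
have loss : \sum_v kappa v * `|imbalance R G H side v / B| <= 3 / 2 * lambda * ((16 * W%:R + 4) * t).
  under eq_bigr do rewrite normrM (gtr0_norm (x := B^-1)) ?invr_gt0 // mulrA.
  rewrite -mulr_suml ler_pdivrMr // (le_trans hside) // [leRHS]mulrAC ler_wpM2l //.
  by have := mulr_gt0 lambda0 B0; lra.
have t0 : 0 <= t by rewrite ler0n.
have w1 : 1 <= W%:R :> R by rewrite ler1n.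
(* The noise costs [(24W + 6) lambda t] and [cut_matching] another [2 lambda t], together at most
   [32 W lambda t]. *)
have : lambda * t * 1 <= lambda * t * W%:R by rewrite ler_wpM2l // mulr_ge0 // ltW.
move: hM' loss; rewrite -/kappa.
move: (\sum_v _ * `|_|) => L hM' loss.
lra.
Qed.

End NearEDCS.

(** * Splitting the vertices *)

Definition copy_at (V : finType) (b : V -> nat) v (i : 'I_(b v)) : {v : V & 'I_(b v)} :=
  Tagged (fun v => 'I_(b v)) i.
Arguments copy_at {V} b v i.

Section Split.
Variables (V E : finType) (G : wmgraph V E) (b : V -> nat).
Implicit Types (H M : {set E}).
Variable f : forall v : V, E -> 'I_(b v).

Definition copy v e : {v : V & 'I_(b v)} := copy_at b v (f v e).

Lemma copy_neq e : copy (end1 G e) e != copy (end2 G e) e.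
Proof. by apply/eqP => /(congr1 tag) /= h; have := end1_neq_end2 G e; rewrite h eqxx. Qed.

(** The edge type stays [E], so edge sets and their weights carry over unchanged. *)
Definition split_graph : wmgraph {v : V & 'I_(b v)} E :=
  @WMGraph _ E (fun e => copy (end1 G e) e) (fun e => copy (end2 G e) e) (weight G) copy_neq.

Lemma incident_split v (i : 'I_(b v)) e :
  incident split_graph (copy_at b v i) e = incident G v e && (f v e == i).
Proof.
rewrite /incident /= -/(copy _ _).
have H u : (copy u e == copy_at b v i) = (u == v) && (f v e == i).
  case: (u =P v) => [uv|uv]; first by subst u; rewrite eq_Tagged.
  by apply/eqP => /(congr1 tag).
by rewrite !H andb_orl.
Qed.

Lemma wdeg_split H v (i : 'I_(b v)) :
  wdeg split_graph H (copy_at b v i) =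
  (\sum_(e in [set e | incident G v e] | f v e == i) if e \in H then weight G e else 0)%N.
Proof.
rewrite /wdeg -big_mkcondr; apply: eq_bigl => e.
by rewrite !inE incident_split andbC.
Qed.

Lemma sum_wdeg_split H v :
  (\sum_(i < b v) wdeg split_graph H (copy_at b v i))%N = wdeg G H v.
Proof.
under eq_bigr do rewrite wdeg_split.
rewrite -(partition_big (f v) xpredT) //= -big_mkcondr /wdeg.
by apply: eq_bigl => e; rewrite !inE andbC.
Qed.

Lemma src_split d : src split_graph d = copy (src G d) d.1.
Proof. by case: d => e []. Qed.

Lemma dst_split d : dst split_graph d = copy (dst G d) d.1.
Proof. by case: d => e []. Qed.

Lemma b_matching_split M : matching split_graph M -> b_matching G b M.
Proof.
move=> /matchingP mM v; rewrite /deg -[leqRHS]card_ord.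
apply: (leq_card_in (f v)) => e e'.
rewrite !inE => /andP[eM ve] /andP[e'M ve'] fe.
by apply: (mM (copy_at b v (f v e))) => //; rewrite incident_split ?ve ?ve' ?fe eqxx.
Qed.

End Split.

(* Injectivity on the classes makes [M] a matching in the split graph, and leaves
   at most two parallel edges between two copies. *)
Definition edge_class (V E : finType) (G : wmgraph V E) (M : {set E}) v e : option V :=
  if e \in M then None else Some (if end1 G e == v then end2 G e else end1 G e).

(** A class holds either edges of [M] at [v], bounded since [M] is a b-matching, or edges parallel
    to one another, bounded by the capacity assumption. *)
Lemma class_size (V E : finType) (G : wmgraph V E) b (M : {set E}) v k :
  capacities G b -> b_matching G b M ->
  (#|[set e in [set e | incident G v e] | edge_class G M v e == k]| <= b v)%N.
Proof.
move=> [_ hb] bM; case: k => [u|]; last first.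
  apply: leq_trans (bM v); apply/subset_leq_card/subsetP => e.
  by rewrite !inE /edge_class; case: (e \in M); rewrite ?andbF //= => /andP[].
have [<-|vu] := eqVneq v u.
  rewrite (_ : [set _ in _ | _] = set0) ?cards0 //; apply/setP => e; rewrite !inE /edge_class.
  apply/negP => /andP[_]; case: (e \in M) => //.
  case: (end1 G e =P v) => [<-|ne] /eqP[] // /eqP.
  by rewrite eq_sym (negbTE (end1_neq_end2 G e)).
apply: leq_trans (leq_trans (hb v u vu) (geq_minl _ _)).
apply/subset_leq_card/subsetP => e; rewrite !inE /edge_class => /andP[ve]; rewrite ve /=.
by case: (e \in M) => // /eqP[<-]; case: ifP; rewrite ?incident_end1 ?incident_end2.
Qed.

Lemma edge_class_dart (V E : finType) (G : wmgraph V E) (M : {set E}) d :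
  edge_class G M (src G d) d.1 = if d.1 \in M then None else Some (dst G d).
Proof.
rewrite /edge_class; case: ifP => // _; congr Some.
case: d => e [] /=; rewrite /dst /src /= ?eqxx //.
by rewrite (negbTE (end1_neq_end2 G e)).
Qed.

Lemma balanced_split (V E : finType) (G : wmgraph V E) b (H M : {set E}) W :
  capacities G b -> weights_in_range G W -> b_matching G b M ->
  exists f : forall v : V, E -> 'I_(b v),
    [/\ matching (split_graph G f) M,
        forall d d' : E * bool, src (split_graph G f) d = src (split_graph G f) d' ->
          dst (split_graph G f) d = dst (split_graph G f) d' ->
          (d.1 \in M) = (d'.1 \in M) -> d = d'
      & forall v i j, (wdeg (split_graph G f) H (copy_at b v i) <=
          wdeg (split_graph G f) H (copy_at b v j) + W)%N].
Proof.
move=> cb wW bM.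
(* Edges outside [H] count with weight 0: the loads are degrees in [H], while injectivity concerns
   all edges. *)
have ex v : exists f : {ffun E -> 'I_(b v)},
  (forall e e', incident G v e -> incident G v e' -> edge_class G M v e = edge_class G M v e' ->
     f e = f e' -> e = e') /\
  (forall i j, (\sum_(e in [set e | incident G v e] | f e == i) (if e \in H then weight G e else 0) <=
     \sum_(e in [set e | incident G v e] | f e == j) (if e \in H then weight G e else 0) + W)%N).
  have b0 : (0 < b v)%N by case: cb.
  have w0 e : e \in [set e | incident G v e] -> ((if e \in H then weight G e else 0) <= W)%N.
    by move=> _; case: ifP => // _; case/andP: (wW e).
  have [f [fi fb]] := balanced_assignment b0 w0 (fun k => class_size v k cb bM).
  exists (finfun f); split=> [e e' ve ve' ce|i j].
    by rewrite !ffunE; apply: fi; rewrite ?inE.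
  have fE k : (\sum_(e in [set e | incident G v e] | finfun f e == k)
          (if e \in H then weight G e else 0) =
      \sum_(e in [set e | incident G v e] | f e == k) (if e \in H then weight G e else 0))%N.
    by apply: eq_bigl => e; rewrite ffunE.
  by rewrite !fE.
have [g hg] := fin_all_exists ex.
exists (fun v => g v); split.
- apply/matchingP => -[v i] e e' eM e'M; rewrite !incident_split =>
    /andP[ve /eqP fe] /andP[ve' /eqP fe'].
  by have [h _] := hg v; apply: h => //; [rewrite /edge_class eM e'M|rewrite fe fe'].
- move=> d d' hs hd hM.
  have vs : src G d = src G d' by move: hs; rewrite !src_split => /(congr1 tag).
  have vd : dst G d = dst G d' by move: hd; rewrite !dst_split => /(congr1 tag).
  apply: (@dart_eqP _ _ G) => //.
  have [h _] := hg (src G d); apply: h; rewrite ?incident_src //.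
  + by rewrite vs incident_src.
  + by rewrite {2}vs !edge_class_dart hM vd.
  + move: hs; rewrite !src_split vs => /eqP; rewrite eq_Tagged => /eqP //.
- by move=> v i j; rewrite !wdeg_split; have [_] := hg v.
Qed.

(** The degrees of the copies of [v] differ pairwise by at most [W], so each is within [W] of their
    average. *)
Lemma split_wdeg_bounds (R : realFieldType) (V E : finType) (G : wmgraph V E) b
    (f : forall v : V, E -> 'I_(b v)) (H : {set E}) (W : nat) :
  (forall v i j, (wdeg (split_graph G f) H (copy_at b v i) <=
          wdeg (split_graph G f) H (copy_at b v j) + W)%N) ->
  forall v (i : 'I_(b v)),
    (wdeg (split_graph G f) H (copy_at b v i))%:R <= (wdeg G H v)%:R / (b v)%:R + W%:R :> R /\
    (wdeg G H v)%:R / (b v)%:R - W%:R <= (wdeg (split_graph G f) H (copy_at b v i))%:R :> R.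
Proof.
move=> bal v i; set x := copy_at b v i.
have b0 : 0 < (b v)%:R :> R by rewrite ltr0n (leq_ltn_trans _ (ltn_ord i)).
have s1 : (b v * wdeg (split_graph G f) H x <= wdeg G H v + b v * W)%N.
  rewrite -(sum_wdeg_split G f) -[in X in (X * wdeg _ _ _)%N](card_ord (b v)).
  rewrite -[in X in (_ + X * W)%N](card_ord (b v)) -!sum_nat_const -big_split /=.
  by apply: leq_sum => j _; apply: bal.
have s2 : (wdeg G H v <= b v * wdeg (split_graph G f) H x + b v * W)%N.
  rewrite -(sum_wdeg_split G f) -mulnDr -[in X in (X * _)%N](card_ord (b v)) -sum_nat_const.
  by apply: leq_sum => j _; apply: bal.
split.
  rewrite -lerBlDr ler_pdivlMr //.
  by move: s1; rewrite -(ler_nat R) !natrD !natrM; lra.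
rewrite lerBlDr ler_pdivrMr //.
by move: s2; rewrite -(ler_nat R) !natrD !natrM; lra.
Qed.

(** * Numerical bounds and the conclusion *)

Lemma ln_ge1 (R : realType) (x : R) : 9 <= x -> 1 <= ln x.
Proof.
move=> x9; rewrite -ler_expR lnK; last by rewrite posrE; lra.
(* This yields [e <= 4], which is below 9. *)
have h : 1 / 2 <= expR (- (1 / 2)) :> R by apply: le_trans (expR_ge1Dx _); lra.
have e0 : 0 < expR (1 / 2) :> R := expR_gt0 _.
have e1 : expR (1 / 2) * expR (- (1 / 2)) = 1 :> R by rewrite -expRD subrr expR0.
have -> : expR 1 = expR (1 / 2) * expR (1 / 2) :> R by rewrite -expRD -splitr.
have h2 : expR (1 / 2) * (1 / 2) <= 1 :> R by rewrite -[leRHS]e1 ler_wpM2l // ltW.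
have : expR (1 / 2) * expR (1 / 2) <= 2 * 2 :> R by apply: ler_pM; lra.
lra.
Qed.

Lemma edge_load_ratr (R : realFieldType) (V E : finType) (G : wmgraph V E) b (H : {set E}) e :
  ratr (edge_load G b H e) = (wdeg G H (end1 G e))%:R / (b (end1 G e))%:R +
    (wdeg G H (end2 G e))%:R / (b (end2 G e))%:R :> R.
Proof. by rewrite /edge_load rmorphD /= !fmorph_div /= !ratr_nat. Qed.

Theorem theorem4 (R : realType) (eps lambda : R) (W : nat)
    (beta beta_minus : int) (V E : finType) (G : wmgraph V E) (b : V -> nat)
    (H M_G : {set E}) :
  0 < eps -> eps < 1 / 2 ->
  (1 <= W)%N ->
  lambda = eps / (100 * W%:R) ->
  3 <= beta -> beta_minus + 2 <= beta ->
  (beta + 6 * W%:Z)%:~R / ln (beta + 6 * W%:Z)%:~R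
    >= 2 * W%:R ^+ 2 * lambda ^- 2 ->
  (beta_minus - 6 * W%:Z)%:~R >= (1 - lambda) * (beta + 6 * W%:Z)%:~R ->
  weights_in_range G W ->
  capacities G b ->
  w_b_EDCS G b beta beta_minus H ->
  max_weight_b_matching G b M_G ->
  exists M_H : {set E},
    [/\ M_H \subset H,
        b_matching G b M_H
      & (2 - 1 / (2 * W%:R) + eps) * (total_weight G M_H)%:R
          >= (total_weight G M_G)%:R].
Proof.
move=> eps0 eps1 W0 lamE beta3 _ hlog hminus wW cb [inH notinH] [bM _].
have w1 : 1 <= W%:R :> R by rewrite ler1n.
have Wlam : W%:R * lambda = eps / 100 by rewrite lamE; field; lra.
have lambda0 : 0 < lambda by rewrite lamE divr_gt0 //; lra.
set B : R := (beta + 6 * W%:Z)%:~R in hlog hminus.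
have BE : B = beta%:~R + 6 * W%:R by rewrite /B rmorphD rmorphM /= !pmulrn.
have beta3R : 3 <= beta%:~R :> R by rewrite -[3]/(3%:~R) ler_int.
have B9 : 9 <= B by lra.
have lnB := ln_ge1 B9.
(* As [ln B >= 1], dropping the logarithm only weakens the hypothesis. *)
have hB : 2 * W%:R ^+ 2 <= lambda ^+ 2 * B.
  rewrite [leRHS]mulrC -ler_pdivrMr ?exprn_gt0 // (le_trans hlog) // ler_pdivrMr; last lra.
  by rewrite ler_peMr //; lra.
have [f [mM par bal]] := balanced_split H cb wW bM.
have bounds := split_wdeg_bounds R bal.
pose G' := split_graph G f.
have wW' : weights_in_range G' W by [].
(* Splitting shifts the load by at most [W] at each end, and [2W <= 6W w(e)] since [w(e) >= 1]. *)
have load_le e : e \in H -> (wdeg G' H (end1 G' e))%:R + (wdeg G' H (end2 G' e))%:R <=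
    B * (weight G' e)%:R :> R.
  move=> eH; have [h1 _] := bounds _ (f (end1 G e) e); have [h2 _] := bounds _ (f (end2 G e) e).
  have := inH e eH; rewrite -(ler_rat R) edge_load_ratr rmorphM /= ratr_int ratr_nat => h.
  apply: (le_trans (lerD h1 h2)); rewrite BE /=.
  have we : 1 <= (weight G e)%:R :> R by rewrite ler1n; case/andP: (wW e).
  have : W%:R * 1 <= W%:R * (weight G e)%:R :> R by rewrite ler_wpM2l.
  lra.
have load_ge e : e \in M_G -> e \notin H -> (1 - lambda) * B * (weight G' e)%:R <=
    (wdeg G' H (end1 G' e))%:R + (wdeg G' H (end2 G' e))%:R :> R.
  move=> _ eH; have [_ h1] := bounds _ (f (end1 G e) e); have [_ h2] := bounds _ (f (end2 G e) e).
  have := notinH e eH; rewrite -(ler_rat R) edge_load_ratr rmorphM /= ratr_int ratr_nat => h.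
  apply: le_trans (lerD h1 h2); rewrite /=.
  have we : 1 <= (weight G e)%:R :> R by rewrite ler1n; case/andP: (wW e).
  have : W%:R * 1 <= W%:R * (weight G e)%:R :> R by rewrite ler_wpM2l.
  have : (1 - lambda) * B * (weight G e)%:R <= (beta_minus%:~R - 6 * W%:R) * (weight G e)%:R.
    apply: ler_wpM2r => //; apply: (le_trans hminus).
    by rewrite rmorphB rmorphM /= !pmulrn.
  lra.
have B0 : 0 < B by lra.
have [M' [sM' mM' hM']] := near_EDCS_matching W0 wW' mM lambda0 B0 load_le load_ge
  (fun d d' _ _ => par d d') hB.
exists M'; split=> //; first exact: b_matching_split mM'.
rewrite Wlam in hM'.
change (total_weight G' M_G) with (total_weight G M_G) in hM'.
change (total_weight G' M') with (total_weight G M') in hM'.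
set t : R := (total_weight G M_G)%:R in hM' *; set t' : R := (total_weight G M')%:R in hM' *.
have t'0 : 0 <= t' by rewrite ler0n.
set k : R := 2 - 1 / (2 * W%:R) in hM' *.
have k2 : k <= 2 by rewrite /k gerBl divr_ge0 // mulr_ge0 // ler0n.
have d0 : 0 < 1 - 32 * (eps / 100) by lra.
(* What remains is [k <= (k + eps)(1 - 8 eps / 25)]: the loss on [k <= 2] is at most [16 eps / 25],
   and [eps (1 - 8 eps / 25) >= 21 eps / 25] for [eps < 1/2]. *)
rewrite -(ler_pM2r d0) (le_trans hM') // mulrAC ler_wpM2r // mulrDl mulrBr mulr1.
have h1 : k * (32 * (eps / 100)) <= 2 * (32 * (eps / 100)) by rewrite ler_wpM2r //; lra.
have h2 : eps * (1 / 2) <= eps * (1 - 32 * (eps / 100)) by rewrite ler_wpM2l //; lra.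
nra.
Qed.
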